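(* Let $a, b, \mu, \nu>0$ be real numbers, and suppose that the following three conditions hold: (i) $\dfrac{\Gamma(a+2\mu)}{\Gamma(a+3\mu)}<\dfrac{\Gamma(b+3\nu)}{3\Gamma(b+2\nu)}$; (ii) $\dfrac{\Gamma(a+\mu)\Gamma(a+3\mu)}{\Gamma^2(a+2\mu)}<\dfrac{3\Gamma^2(b+2\nu)}{2\Gamma(b+\nu)\Gamma(b+3\nu)}$; (iii) $\dfrac{2\Gamma(a)\Gamma(b)}{\Gamma(a+\mu)\Gamma(b+\nu)}+\dfrac{3(e-1)\Gamma(a)\Gamma(b)}{\Gamma(a+2\mu)\Gamma(b+2\nu)}<1$. Then the function $\mathbb{W}_{(\mu,a),(\nu,b)}(z)$ is starlike in $\mathbb{D}$.
   Context: $\mathbb{D}=\{z\in\mathbb{C}:|z|<1\}$. The normalized four parameters Wright function is $$\mathbb{W}_{(\mu,a),(\nu,b)}(z)=\sum_{k=0}^{\infty}\frac{\Gamma(a)\Gamma(b)}{\Gamma(a+k\mu)\Gamma(b+k\nu)}\,z^{k+1}.$$ An analytic function $f$ on $\mathbb{D}$ with $f(0)=0$, $f'(0)=1$ is called starlike in $\mathbb{D}$ if $f$ is univalent in $\mathbb{D}$ and $f(\mathbb{D})$ is a star-shaped domain with respect to $0$; equivalently, $\Re\left(zf'(z)/f(z)\right)>0$ for all $z\in\mathbb{D}$. *)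

(* Defs.v *)
From HB Require Import structures.
From mathcomp Require Import all_boot all_order all_algebra.
From mathcomp Require Import complex.
From mathcomp Require Import all_classical all_reals all_analysis.

Set Implicit Arguments.
Unset Strict Implicit.
Unset Printing Implicit Defensive.

Import Order.TTheory GRing.Theory Num.Theory.
Import numFieldNormedType.Exports.

Local Open Scope classical_set_scope.
Local Open Scope ring_scope.
Local Open Scope complex_scope.

(** Euler's integral; it represents the Gamma function for [0 < x], the only
    arguments used. *)
Definition Gamma (R : realType) (x : R) : R :=
  \int[@lebesgue_measure R]_(t in `]0, +oo[) (t `^ (x - 1) * expR (- t)).

Section Wright.
Context {R : realType} (mu a nu b : R).

Definition wright_coef (k : nat) : R :=
  Gamma a * Gamma b / (Gamma (a + k%:R * mu) * Gamma (b + k%:R * nu)).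

(** [R[i]^o] is [R[i]] with its canonical normed module structure over itself,
    so limits and derivatives below are complex ones. *)
Definition wright (z : R[i]^o) : R[i]^o :=
  limn (series (fun k => (wright_coef k)%:C * z ^+ k.+1 : R[i]^o)).

End Wright.

Section Starlike.
Context {R : realType}.
Implicit Types (A : set R[i]^o) (f : R[i]^o -> R[i]^o).

(** The norm of [R[i]] is [R[i]]-valued; [`|z| < 1] compares real numbers. *)
Definition unit_disc : set R[i]^o := [set z | `|z| < 1].

Definition domain A := [/\ A !=set0, open A & connected A].

Definition star_shaped0 A :=
  forall w, A w -> forall t : R, 0 <= t <= 1 -> A (t%:C * w).

(** Complex differentiability at every point of [A]. *)
Definition analytic_on A f := forall z, A z -> derivable f z 1.

Definition univalent_on A f := analytic_on A f /\ set_inj A f.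

Definition starlike f :=
  [/\ analytic_on unit_disc f, f 0 = 0 & f^`()%classic 0 = 1] /\
  [/\ univalent_on unit_disc f,
      domain (f @` unit_disc) & star_shaped0 (f @` unit_disc)].

End Starlike.

(* Main.v *)
(** Only condition (iii) and the log-convexity of Gamma are needed.  By
    log-convexity the coefficients [c k] of the Wright function satisfy
    [c k * c (k+2) <= c (k+1) ^ 2], so [c (k+1) / c k] is nonincreasing; with
    [c 0 = 1] and (iii), in which [e >= 8/3], this ratio is at most 29/100 from
    [k = 1] on, and summing yields [M + N < 1] for [M] the sum of the [k * c k]
    and [N] the sum of the [c k], over [k >= 1].

    Then [f] differs from the identity by a contraction of ratio [M + N] on the
    closed disc, which gives injectivity and, by iterating [v |-> v + (y - f v)],
    local surjectivity, without any complex analysis.  Moreover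
    [(f u - f v) / (u - v)] lies within [M] of [f v / v], whose modulus is at
    least [1 - N > M]; hence [f v = s * f u] with [0 < s <= 1] forces
    [|v| <= |u|].  So the segment from [f z] to [0] can be lifted through [f] by
    small steps that never leave the disc of radius [|z|]. *)

Require Import Defs.
From mathcomp Require Import all_boot all_order all_algebra.
From mathcomp Require Import complex.
From mathcomp Require Import all_classical all_reals all_analysis.
From mathcomp Require Import measurable_realfun ring lra.

Import Order.TTheory GRing.Theory Num.Theory.
Import numFieldNormedType.Exports.

Local Open Scope classical_set_scope.
Local Open Scope ring_scope.

(** * The Gamma function *)

(** Monotone convergence along compact intervals exhausting the half-line: on each of them the
    fundamental theorem of calculus bounds the integral by [B + B]. *)
Lemma bounded_primitive_integrable {R : realType} (f F : R -> R) (B : R) :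
  (forall t : R, 0 < t -> 0 <= f t) ->
  (forall t : R, 0 < t -> {for t, continuous f}) ->
  (forall t : R, 0 < t -> is_derive t (1 : R) F (f t)) ->
  (forall t : R, 0 < t -> `|F t| <= B) ->
  (@lebesgue_measure R).-integrable `]0, +oo[%classic (EFin \o f).
Proof.
move=> f0 cf dF FB.
(* The right end [n + 2] keeps the interval nondegenerate at [n = 0]. *)
pose A n := `[n.+1%:R^-1, n.+2%:R]%classic : set R.
have A_gt0 n t : A n t -> 0 < t.
  by rewrite /A /= in_itv /= => /andP[+ _]; apply: lt_le_trans; rewrite invr_gt0.
have An n : (n.+1%:R^-1 : R) < n.+2%:R.
  apply: (@le_lt_trans _ _ 1); last by rewrite ltr1n.
  by rewrite invf_le1// ler1n.
have homoA : {homo A : n m / (n <= m)%N >-> (n <= m)%O}.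
  move=> n m nm; apply/subsetPset => t; rewrite /A /= !in_itv /= => /andP[t1 t2].
  rewrite (le_trans _ t1) ?(le_trans t2)//= ?ler_nat//.
  by rewrite lef_pV2 ?posrE// ler_nat.
have mf : measurable_fun (`]0, +oo[%classic : set R) f.
  apply: open_continuous_measurable_fun => // t.
  by rewrite inE /= in_itv /= andbT => /cf.
have mA n : measurable (A n) by exact: measurable_itv.
have mfA n : measurable_fun (A n) f.
  apply: measurable_funS mf => // t /A_gt0.
  by rewrite /= in_itv /= andbT.
have UA : (\bigcup_n A n)%classic = `]0, +oo[%classic.
  apply/seteqP; split=> [t [n _ /A_gt0 t0]|t]; rewrite /= in_itv /= andbT//.
  (* Since [m + 1] exceeds both [t] and [t^-1], one index takes care of both ends. *)
  move=> t0; pose m := Num.trunc (t + t^-1); exists m => //=.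
  have ti : 0 < t^-1 by rewrite invr_gt0.
  have tm : t + t^-1 < m.+1%:R by exact: truncnS_gt.
  rewrite /A /= in_itv /=; apply/andP; split.
    rewrite -[leRHS]invrK lef_pV2 ?posrE// ltW// (le_lt_trans _ tm)//.
    by rewrite lerDr ltW.
  rewrite ltW// (le_lt_trans _ (lt_trans tm _)) ?ltr_nat//.
  by rewrite lerDl ltW.
apply/integrableP; split; first exact/measurable_EFinP.
have -> : (\int[lebesgue_measure]_(x in `]0%R, +oo[%classic) `|(EFin \o f) x| =
           \int[lebesgue_measure]_(x in `]0%R, +oo[%classic) (f x)%:E)%E.
  apply: eq_integral => t; rewrite inE /= in_itv /= andbT => t0.
  by rewrite ger0_norm// f0.
rewrite -UA.
apply: (@le_lt_trans _ _ (B + B)%:E); last by rewrite ltry.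
have mfE n : measurable_fun (A n) (EFin \o f) by exact/measurable_EFinP.
have fE0 n t : A n t -> (0 <= (EFin \o f) t)%E.
  by move=> /A_gt0 t0; rewrite /= lee_fin f0.
have cv : ((\int[lebesgue_measure]_(x in A i) (f x)%:E)%E @[i --> \oo] -->
    (\int[lebesgue_measure]_(x in \bigcup_i A i) (f x)%:E)%E)%classic.
  exact: (@ge0_nondecreasing_set_cvg_integral _ (measurableTypeR R) R A
    (EFin \o f) (@lebesgue_measure R) homoA mA mfE fE0).
rewrite -(cvg_lim _ cv)//.
apply: lime_le; first by apply/cvg_ex; eexists; exact: cv.
apply: nearW => n.
have dFt (t : R) : 0 < t -> derivable F t 1 by move=> /dF[].
have cF (t : R) : 0 < t -> (F x @[x --> t] --> F t)%classic.
  by move=> t0; apply: differentiable_continuous; apply/derivable1_diffP/dFt.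
have n0 : (0 : R) < n.+1%:R^-1 by rewrite invr_gt0.
rewrite (@continuous_FTC2 _ f F)//.
- rewrite -EFinB lee_fin (le_trans (ler_norm _))// (le_trans (ler_normB _ _))//.
  by rewrite lerD// FB.
- apply/subspace_continuousP => t /A_gt0 /cf tf.
  by apply: cvg_within_filter.
- split.
  + by move=> t; rewrite in_itv /= => /andP[+ _] => /(lt_trans n0)/dFt.
  + exact/cvg_at_right_filter/cF.
  + exact/cvg_at_left_filter/cF.
- move=> t; rewrite in_itv /= => /andP[+ _] => /(lt_trans n0)/dF dFt'.
  by rewrite derive1E derive_val.
Qed.

Lemma powR_exp {R : realType} (t x : R) : 0 < t -> t `^ x = expR (x * ln t).
Proof. by move=> t0; rewrite /powR gt_eqF. Qed.

(** This is [ln s <= s - 1] at [s = t / (2 x)]; the function [t^x e^(-t/2)] is largest at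
    [t = 2 x]. *)
Lemma powR_le_expR {R : realType} (x t : R) : 0 < x -> 0 < t ->
  t `^ x <= expR (x * (ln (2 * x) - 1)) * expR (t / 2).
Proof.
move=> x0 t0; rewrite powR_exp// -expRD ler_expR.
have tx : 0 < t / (2 * x) by rewrite divr_gt0// mulr_gt0.
have -> : ln t = ln (t / (2 * x)) + ln (2 * x).
  by rewrite -lnM ?posrE ?tx ?mulr_gt0// divfK// gt_eqF// mulr_gt0.
have : ln (t / (2 * x)) <= t / (2 * x) - 1.
  by have := expR_ge1Dx (ln (t / (2 * x))); rewrite lnK ?posrE//; lra.
move=> /(ler_wpM2l (ltW x0)).
have -> : x * (t / (2 * x) - 1) = t / 2 - x by field; rewrite gt_eqF.
by rewrite mulrDr mulrBr mulr1; lra.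
Qed.

Lemma Gamma_integrand_ge0 {R : realType} (x t : R) :
  0 <= t `^ (x - 1) * expR (- t).
Proof. by rewrite mulr_ge0 ?powR_ge0 ?expR_ge0. Qed.

Lemma measurable_Gamma_integrand {R : realType} (x : R) (A : set R) :
  measurable_fun A (fun t : R => t `^ (x - 1) * expR (- t)).
Proof.
apply: measurable_funTS; apply: measurable_funM; first exact: measurable_powR.
exact: measurableT_comp.
Qed.

(* The integrand is dominated by a multiple of [t^(x-1) / (1 + t^x)^2], which
   has the bounded primitive [- 1 / (x (1 + t^x))]. *)
Lemma Gamma_integrable {R : realType} (x : R) : 0 < x ->
  (@lebesgue_measure R).-integrable `]0, +oo[%classic
    (EFin \o (fun t => t `^ (x - 1) * expR (- t))).
Proof.
(* [K] is chosen so that [1 + t^x <= K e^(t/2)]; squaring this produces an [e^t] that cancels the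
   factor [e^(-t)]. *)
move=> x0; pose K := 1 + expR (x * (ln (2 * x) - 1)).
have K0 : 0 < K by rewrite ltr_wpDr ?expR_ge0.
pose g (t : R) := K ^+ 2 * (t `^ (x - 1) * (1 + t `^ x) ^- 2).
pose G (t : R) := - (K ^+ 2 / x) * (1 + t `^ x)^-1.
have den0 (t : R) : 0 < 1 + t `^ x by rewrite ltr_wpDr ?powR_ge0.
have e0 (t : R) : K ^+ 2 * expR (t / 2) ^+ 2 * expR (- t) = K ^+ 2.
  rewrite -mulrA -expRM_natl -expRD mulr_natl -[in X in X + _]mulr_natr.
  by rewrite divfK// subrr expR0 mulr1.
apply: (@le_integrable _ (measurableTypeR R) R (@lebesgue_measure R) _ _ _
  (EFin \o g)).
- exact: measurable_itv.
- by apply/measurable_EFinP; exact: measurable_Gamma_integrand.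
- move=> t; rewrite /= in_itv /= andbT => t0; rewrite lee_fin.
  rewrite (ger0_norm (Gamma_integrand_ge0 _ _)) ger0_norm; last first.
    by rewrite /g mulr_ge0 ?sqr_ge0// mulr_ge0 ?powR_ge0// invr_ge0 sqr_ge0.
  rewrite /g mulrCA ler_wpM2l ?powR_ge0// ler_pdivlMr ?exprn_gt0//.
  have : 1 + t `^ x <= K * expR (t / 2).
    rewrite mulrDl mul1r lerD ?powR_le_expR//.
    by rewrite -expR0 ler_expR divr_ge0// ltW.
  move=> /(@lerXn2r _ 2 _ _) ; rewrite !nnegrE (ltW (den0 t)).
  rewrite mulr_ge0 ?(ltW K0) ?expR_ge0// => /(_ isT isT) h.
  rewrite mulrC (le_trans (ler_wpM2r (expR_ge0 _) h))//.
  by rewrite exprMn e0.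
- apply: (@bounded_primitive_integrable R g G (K ^+ 2 / x)).
  + move=> t t0; rewrite /g mulr_ge0 ?sqr_ge0// mulr_ge0 ?powR_ge0//.
    by rewrite invr_ge0 sqr_ge0.
  + move=> t t0.
    have cp (y : R) : {for t, continuous (fun u : R => u `^ y)}.
      apply: differentiable_continuous; apply/derivable1_diffP.
      by case: (is_derive1_powR y t0).
    rewrite /g; apply: continuousM; first exact: cvg_cst.
    apply: continuousM; first exact: cp.
    apply: continuousV; first by rewrite expf_neq0// gt_eqF.
    have c1 : {for t, continuous (fun u : R => 1 + u `^ x)}.
      by apply: continuousD; [exact: cvg_cst|exact: cp].
    exact: (continuousM c1 c1).
  + move=> t t0; rewrite /G.
    have d1 := is_derive1_powR x t0.
    have n0 : 1 + t `^ x != 0 by rewrite gt_eqF.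
    have d2 : is_derive t (1 : R) (fun u : R => 1 + u `^ x)
        (0 + x * t `^ (x - 1)).
      exact: is_deriveD.
    have d3 := @is_deriveV _ (fun u : R => 1 + u `^ x) t _ 1 n0 d2.
    have d4 := @is_deriveZ _ _ _ _ (- (K ^+ 2 / x)) _ _ _ d3.
    apply: is_derive_eq d4 _.
    rewrite add0r /g /GRing.scale /=.
    by field; rewrite n0 gt_eqF.
  + move=> t t0; rewrite /G normrM normrN normfV (ger0_norm (ltW (den0 t))).
    have Kx : 0 <= K ^+ 2 / x by rewrite divr_ge0 ?sqr_ge0 ?ltW.
    by rewrite (ger0_norm Kx) ler_piMr// invf_le1// lerDl powR_ge0.
Qed.

(** On [[1, 2]] the integrand is at least [e^(-2) / 2], whatever [x > 0]. *)
Lemma Gamma_gt0 {R : realType} (x : R) : 0 < x -> 0 < Gamma x.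
Proof.
move=> x0; pose f (t : R) := t `^ (x - 1) * expR (- t).
have mf (A : set R) : measurable_fun A (EFin \o f).
  by apply/measurable_EFinP; exact: measurable_Gamma_integrand.
have h1 : ((2^-1 * expR (- 2))%R%:E <=
    \int[@lebesgue_measure R]_(t in `[(1 : R)%R, (2 : R)%R]%classic) (f t)%:E)%E.
  have -> : ((2^-1 * expR (- 2))%R%:E =
    \int[@lebesgue_measure R]_(t in `[(1 : R)%R, (2 : R)%R]%classic)
      (2^-1 * expR (- 2))%R%:E)%E.
    rewrite integral_cst//= lebesgue_measure_itv/= lte_fin ltr1n -EFinB -EFinM.
    by congr EFin; ring.
  apply: ge0_le_integral => //=.
  - exact: mf.
  - move=> t; rewrite in_itv /= => /andP[t1 t2].
    have t0 : 0 < t by rewrite (lt_le_trans _ t1).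
    rewrite lee_fin /f ler_pM ?expR_ge0//; last by rewrite ler_expR lerN2.
    (* [t^(x-1) >= 1/2] because [(x - 1) ln t >= - ln t >= - ln 2]. *)
    rewrite powR_exp// -(@lnK _ (2^-1)) ?posrE// ler_expR lnV ?posrE//.
    have l2 : ln t <= ln 2 by rewrite ler_ln ?posrE.
    have l0 : 0 <= ln t by rewrite ln_ge0.
    by have := mulr_ge0 (ltW x0) l0; lra.
have h2 :
    (\int[@lebesgue_measure R]_(t in `[(1 : R)%R, (2 : R)%R]%classic) (f t)%:E <=
    \int[@lebesgue_measure R]_(t in `]0%R, +oo[%classic) (f t)%:E)%E.
  apply: ge0_subset_integral => //=.
  - exact: mf.
  - by move=> t _; rewrite lee_fin Gamma_integrand_ge0.
  - move=> t; rewrite /= !in_itv /= andbT => /andP[t1 _].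
    by rewrite (lt_le_trans _ t1).
have h3 : (0 < \int[@lebesgue_measure R]_(t in `]0%R, +oo[%classic) (f t)%:E)%E.
  by apply: lt_le_trans (le_trans h1 h2); rewrite lte_fin mulr_gt0 ?expR_gt0.
(* [fine] sends [+oo] to 0, so positivity of [Gamma] also requires the integral to be finite. *)
rewrite /Gamma /Rintegral fine_gt0// h3 /=.
have : ((\int[@lebesgue_measure R]_(t in `]0%R, +oo[%classic) (f t)%:E)%E
    \is a fin_num).
  apply: integrable_fin_num; last exact: Gamma_integrable.
  exact: measurable_itv.
by rewrite fin_numElt => /andP[].
Qed.

(* [t^(x-1) (1 - l t^h)^2 e^(-t)] has a nonnegative integral for
   [l = Gamma (x + h) / Gamma (x + 2 h)]. *)
Lemma Gamma_log_convex {R : realType} (x h : R) : 0 < x -> 0 < h ->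
  Gamma (x + h) ^+ 2 <= Gamma x * Gamma (x + h + h).
Proof.
move=> x0 h0.
have xh0 : 0 < x + h by rewrite addr_gt0.
have xhh0 : 0 < x + h + h by rewrite addr_gt0.
have G2 := Gamma_gt0 _ xhh0.
pose f y (t : R) : R := t `^ (y - 1) * expR (- t).
pose l := Gamma (x + h) / Gamma (x + h + h).
have mZ r y : 0 < y -> (@lebesgue_measure R).-integrable `]0, +oo[%classic
    (EFin \o (fun t => r * f y t)).
  by move=> y0; apply: (integrableZl _ r (Gamma_integrable y y0)).
have powD (t r s : R) : 0 < t -> t `^ (r + s) = t `^ r * t `^ s.
  by move=> t0; rewrite powRD//; apply/implyP; rewrite (gt_eqF t0).
have pointwise (t : R) : 0 < t -> 2 * l * f (x + h) t <=
    f x t + l ^+ 2 * f (x + h + h) t.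
  move=> t0; rewrite /f.
  have e1 : t `^ (x + h - 1) = t `^ (x - 1) * t `^ h.
    by rewrite addrAC (powD _ (x - 1)).
  have e2 : t `^ (x + h + h - 1) = t `^ (x - 1) * t `^ h ^+ 2.
    by rewrite addrAC (powD _ (x + h - 1))// e1 expr2 mulrA.
  rewrite e1 e2 -subr_ge0.
  rewrite (_ : _ - _ = t `^ (x - 1) * expR (- t) * (1 - l * t `^ h) ^+ 2).
    by rewrite mulr_ge0 ?sqr_ge0 ?Gamma_integrand_ge0.
  ring.
have : 2 * l * Gamma (x + h) <= Gamma x + l ^+ 2 * Gamma (x + h + h).
  rewrite /Gamma -!RintegralZl ?Gamma_integrable//.
  rewrite -RintegralD ?Gamma_integrable//; last exact: mZ.
  apply: le_Rintegral => //.
  - exact: mZ.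
  - apply: (@integrableD _ (measurableTypeR R) R (@lebesgue_measure R) _ _
      (EFin \o f x) (EFin \o (fun t => l ^+ 2 * f (x + h + h) t))).
    + exact: measurable_itv.
    + exact: Gamma_integrable.
    + exact: mZ.
  - by move=> t; rewrite /= in_itv /= andbT; exact: pointwise.
(* The chosen [l] minimizes [Gamma x - 2 l Gamma (x + h) + l^2 Gamma (x + 2 h)], so nonnegativity
   there is exactly the claim. *)
have -> : l ^+ 2 * Gamma (x + h + h) = l * Gamma (x + h).
  by rewrite /l; field; rewrite gt_eqF.
have -> : 2 * l * Gamma (x + h) = l * Gamma (x + h) + l * Gamma (x + h) by ring.
by rewrite lerD2r /l mulrAC -expr2 ler_pdivrMr.
Qed.

(** * The modulus on [R[i]] and convergence of complex series *)

(* The norm [`|z|] of [R[i]] takes values in [R[i]]; this one is real-valued. *)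
Local Notation cn := Normc.normc.

Lemma cnE {R : rcfType} (z : R[i]) : `|z| = (cn z)%:C%C.
Proof. by []. Qed.

Lemma cn_ge0 {R : rcfType} (z : R[i]) : 0 <= cn z.
Proof. by case: z => a b; rewrite sqrtr_ge0. Qed.

Lemma cnD {R : rcfType} (x y : R[i]) : cn (x + y) <= cn x + cn y.
Proof. exact: le_normcD. Qed.

Lemma cnN {R : rcfType} (x : R[i]) : cn (- x) = cn x.
Proof. exact: normcN. Qed.

Lemma cnB {R : rcfType} (x y : R[i]) : cn (x - y) <= cn x + cn y.
Proof. by rewrite -(cnN y) cnD. Qed.

Lemma cn_subC {R : rcfType} (x y : R[i]) : cn (x - y) = cn (y - x).
Proof. by rewrite -cnN opprB. Qed.

Lemma cn_real {R : rcfType} (x : R) : cn x%:C%C = `|x|.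
Proof. by rewrite /= expr0n /= addr0 sqrtr_sqr. Qed.

Lemma cnX {R : rcfType} (x : R[i]) n : cn (x ^+ n) = cn x ^+ n.
Proof.
by elim: n => [|n IH]; rewrite ?expr0 ?Normc.normc1// !exprS Normc.normcM IH.
Qed.

Lemma cn_sum {R : rcfType} (I : Type) (r : seq I) (P : pred I) (F : I -> R[i]) :
  cn (\sum_(i <- r | P i) F i) <= \sum_(i <- r | P i) cn (F i).
Proof.
elim/big_rec2: _ => [|i y x _ h]; first by rewrite Normc.normc0.
by rewrite (le_trans (cnD _ _))// lerD2l.
Qed.

Lemma cn_sqr {R : rcfType} (z : R[i]) :
  cn z ^+ 2 = complex.Re z ^+ 2 + complex.Im z ^+ 2.
Proof. by case: z => a b; rewrite /= sqr_sqrtr// addr_ge0 ?sqr_ge0. Qed.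

Lemma cn_Re {R : rcfType} (z : R[i]) : `|complex.Re z| <= cn z.
Proof.
rewrite -(@ler_pXn2r _ 2)// ?nnegrE ?cn_ge0// cn_sqr real_normK ?num_real//.
by rewrite lerDl sqr_ge0.
Qed.

Lemma cn_Im {R : rcfType} (z : R[i]) : `|complex.Im z| <= cn z.
Proof.
rewrite -(@ler_pXn2r _ 2)// ?nnegrE ?cn_ge0// cn_sqr real_normK ?num_real//.
by rewrite lerDr sqr_ge0.
Qed.

Lemma cn_le_ReIm {R : rcfType} (z : R[i]) :
  cn z <= `|complex.Re z| + `|complex.Im z|.
Proof.
rewrite -(@ler_pXn2r _ 2)// ?nnegrE ?cn_ge0 ?addr_ge0// cn_sqr sqrrD.
by rewrite !real_normK ?num_real// addrAC lerDl mulrn_wge0// mulr_ge0.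
Qed.

Lemma ReD {R : rcfType} (x y : R[i]) :
  complex.Re (x + y) = complex.Re x + complex.Re y.
Proof. by case: x y => a b []. Qed.

Lemma ImD {R : rcfType} (x y : R[i]) :
  complex.Im (x + y) = complex.Im x + complex.Im y.
Proof. by case: x y => a b []. Qed.

Lemma cn_eq0 {R : rcfType} (z : R[i]) : (cn z == 0) = (z == 0).
Proof.
by apply/eqP/eqP => [/Normc.eq0_normc //|->]; rewrite Normc.normc0.
Qed.

(** Radii of balls live in [R[i]], where [0 < e] means that [e] has zero imaginary part and positive
    real part; real radii therefore suffice. *)
Lemma cvg_cnP {R : realType} (u : nat -> R[i]^o) (l : R[i]^o) :
  (u n @[n --> \oo] --> l)%classic <->
  (forall e : R, 0 < e -> \forall n \near \oo, cn (l - u n) < e).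
Proof.
split=> [/cvgrPdist_lt h e e0|h].
  have : (0 : R[i]) < e%:C%C by rewrite ltcR.
  by move=> /h; apply: filterS => n; rewrite cnE ltcR.
apply/cvgrPdist_lt => e e0.
have [Ime Ree] : complex.Im e = 0 /\ 0 < complex.Re e.
  by move: e0; rewrite ltcE => /andP[/eqP].
apply: filterS (h _ Ree) => n; rewrite cnE -ltcR => /lt_le_trans; apply.
by rewrite lecE /= Ime eqxx lexx.
Qed.

Lemma cn_lim_le {R : realType} (u : nat -> R[i]^o) (l : R[i]^o) (B : R) :
  (u n @[n --> \oo] --> l)%classic -> (\forall n \near \oo, cn (u n) <= B) ->
  cn l <= B.
Proof.
move=> /cvg_cnP ul uB; apply/ler_addgt0Pr => e /ul ule.
near \oo => n.
have -> : l = u n + (l - u n) by rewrite addrC subrK.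
rewrite (le_trans (cnD _ _))// lerD//; near: n => //.
by apply: filterS ule => n /ltW.
Unshelve. all: end_near. Qed.

Lemma cvg_ReIm {R : realType} (u : nat -> R[i]^o) (a b : R) :
  (complex.Re (u n) @[n --> \oo] --> a)%classic ->
  (complex.Im (u n) @[n --> \oo] --> b)%classic ->
  (u n @[n --> \oo] --> ((a +i* b)%C : R[i]^o))%classic.
Proof.
move=> /cvgrPdist_lt ua /cvgrPdist_lt ub; apply/cvg_cnP => e e0.
have e20 : 0 < e / 2 by rewrite divr_gt0.
near=> n; rewrite (le_lt_trans (cn_le_ReIm _))// (splitr e) ltrD//.
  have -> : complex.Re ((a +i* b)%C - u n) = a - complex.Re (u n) by case: (u n).
  by near: n; exact: ua.
have -> : complex.Im ((a +i* b)%C - u n) = b - complex.Im (u n) by case: (u n).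
by near: n; exact: ub.
Unshelve. all: end_near. Qed.

Lemma real_series_cvg {R : realType} (v w : nat -> R) (B : R) :
  (forall k, `|v k| <= w k) -> (forall n, \sum_(0 <= k < n) w k <= B) ->
  cvgn (series v).
Proof.
move=> vw wB; apply: normed_cvg.
have w0 n : 0 <= w n by rewrite (le_trans _ (vw n)).
apply: (@series_le_cvg _ _ w) => //.
  by move=> n /=.
apply: nondecreasing_is_cvgn.
  by apply: nondecreasing_series => n _ _; exact: w0.
by exists B => _ [n _ <-]; exact: wB.
Qed.

(** The real and imaginary parts are real series dominated termwise by the moduli. *)
Lemma complex_series_cvg {R : realType} (u : nat -> R[i]^o) (B : R) :
  (forall n, \sum_(0 <= k < n) cn (u k) <= B) -> cvgn (series u).
Proof.
move=> uB.
have /cvg_ex[a ua] : cvgn (series (fun k => complex.Re (u k))).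
  by apply: real_series_cvg uB => k; exact: cn_Re.
have /cvg_ex[b ub] : cvgn (series (fun k => complex.Im (u k))).
  by apply: real_series_cvg uB => k; exact: cn_Im.
apply/cvg_ex; exists ((a +i* b)%C : R[i]^o); apply: cvg_ReIm.
  suff -> : (fun n => complex.Re (series u n)) =
    series (fun k => complex.Re (u k)) by [].
  by apply/funext => n; rewrite /series /= (big_morph _ (@ReD R) erefl).
suff -> : (fun n => complex.Im (series u n)) =
  series (fun k => complex.Im (u k)) by [].
by apply/funext => n; rewrite /series /= (big_morph _ (@ImD R) erefl).
Qed.

(** * Maps close to the identity: local surjectivity and radial monotonicity *)

Lemma near_id_surjective {R : realType} (f : R[i]^o -> R[i]^o) (L r : R)
    (z0 y : R[i]^o) :
  0 <= L -> L < 1 -> 0 <= r ->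
  (forall u v : R[i]^o, cn (u - z0) <= r -> cn (v - z0) <= r ->
    cn (f u - f v - (u - v)) <= L * cn (u - v)) ->
  cn (y - f z0) <= (1 - L) * r ->
  exists2 v : R[i]^o, cn (v - z0) <= r & f v = y.
Proof.
move=> L0 L1 r0 fL yz.
(* The iterated map is a contraction of ratio [L] whose fixed points solve [f v = y]. The steps are
   at most [L^n (1 - L) r], so their sum [(1 - L^n) r] never leaves the ball. *)
pose v n := iter n (fun w : R[i]^o => w + (y - f w)) z0.
have vS n : v n.+1 = v n + (y - f (v n)) by [].
have Ln0 n : 0 <= L ^+ n by rewrite exprn_ge0.
have Ln n : (1 - L ^+ n) * r <= r by rewrite ler_piMl// gerBl.
have step n : cn (v n - z0) <= (1 - L ^+ n) * r /\
    cn (v n.+1 - v n) <= L ^+ n * ((1 - L) * r).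
  elim: n => [|n [IH1 IH2]].
    rewrite subrr Normc.normc0 expr0 subrr mul0r lexx mul1r.
    by rewrite vS addrAC subrr add0r.
  have h1 : cn (v n.+1 - z0) <= (1 - L ^+ n.+1) * r.
    have -> : v n.+1 - z0 = (v n - z0) + (v n.+1 - v n) by ring.
    rewrite (le_trans (cnD _ _))// (le_trans (lerD IH1 IH2))//.
    by rewrite exprS; lra.
  split=> //.
  have -> : v n.+2 - v n.+1 = - (f (v n.+1) - f (v n) - (v n.+1 - v n)).
    by rewrite (vS n.+1) {3}(vS n); ring.
  rewrite cnN (le_trans (fL _ _ _ _))//.
  - exact: le_trans h1 _.
  - exact: le_trans IH1 _.
  - by rewrite exprS -mulrA ler_wpM2l.
(* The iterates are the partial sums of their telescoping series, whose moduli add up to at most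
   [r]. *)
have /cvg_ex[l vl] : cvgn v.
  have -> : v = (fun n => v 0%N + series (telescope v) n).
    by apply/funext => n; exact: eq_sum_telescope.
  apply: is_cvgD; first exact: is_cvg_cst.
  apply: (@complex_series_cvg _ _ r) => n.
  apply: (@le_trans _ _ ((1 - L ^+ n) * r)) => //.
  elim: n => [|n IH]; first by rewrite big_geq// expr0 subrr mul0r.
  rewrite big_nat_recr//= (le_trans (lerD IH (step n).2))// exprS; lra.
have lr : cn (l - z0) <= r.
  apply: (@cn_lim_le _ (fun n => v n - z0)).
    exact: (cvgB vl (cvg_cst z0)).
  by apply: nearW => n; exact: le_trans (step n).1 _.
exists l => //; apply/eqP; rewrite eq_sym -subr_eq0 -cn_eq0 eq_le cn_ge0 andbT.
apply/ler_addgt0Pr => e e0; rewrite add0r.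
have e20 : 0 < e / 2 by rewrite divr_gt0.
have vSl : (v n.+1 @[n --> \oo] --> l)%classic by rewrite cvg_shiftS.
near \oo => n.
(* Closeness of [f] to the identity replaces continuity: both terms are controlled by distances from
   iterates to [l]. *)
have -> : y - f l = - (l - v n.+1) + (f (v n) - f l - (v n - l)).
  by rewrite vS; ring.
rewrite (le_trans (cnD _ _))// (splitr e) cnN lerD//.
  by rewrite ltW//; near: n; move/cvg_cnP: vSl; exact.
rewrite (le_trans (fL _ _ _ _))//; first exact: le_trans (step n).1 _.
rewrite cn_subC (@le_trans _ _ (cn (l - v n)))//.
  by rewrite ler_piMl ?cn_ge0 ?ltW.
by rewrite ltW//; near: n; move/cvg_cnP: vl; exact.
Unshelve. all: end_near. Qed.

(* With [f u - f v = e * f v], [e >= 0], the second hypothesis gives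
   [|e v - (u - v)| <= |u - v|], hence [Re (conj v * (u - v)) >= 0]. *)
Lemma radial_monotone {R : realType} (f : R[i]^o -> R[i]^o) (M N s : R)
    (u v : R[i]^o) :
  0 <= M -> M + N < 1 -> 0 < s -> s <= 1 ->
  cn (f v - v) <= N * cn v ->
  cn (v * (f u - f v) - (u - v) * f v) <= M * cn (u - v) * cn v ->
  f v = s%:C%C * f u -> cn v <= cn u.
Proof.
move=> M0 MN s0 s1 fv fuv fvu.
have aux (e : R) (z d : R[i]^o) : 0 < e ->
    cn (e%:C%C * z - d) ^+ 2 <= cn d ^+ 2 -> cn z ^+ 2 <= cn (z + d) ^+ 2.
  move=> egt0; rewrite !cn_sqr; case: z d => [a b] [p q] /=.
  rewrite !(mul0r, subr0, addr0) => h.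
  suff : 0 <= a * p + b * q by have := sqr_ge0 p; have := sqr_ge0 q; lra.
  suff : 0 <= 2 * e * (a * p + b * q) by rewrite pmulr_rge0// mulr_gt0.
  have := sqr_ge0 (e * a); have := sqr_ge0 (e * b); lra.
have [->|vn0] := eqVneq v 0; first by rewrite Normc.normc0 cn_ge0.
have v0 : 0 < cn v by rewrite lt_def cn_eq0 vn0 cn_ge0.
pose e := s^-1 - 1.
have e0 : 0 <= e by rewrite subr_ge0 invf_ge1.
have fe : f u - f v = e%:C%C * f v.
  have -> : f u = (s^-1)%:C%C * f v.
    by rewrite fvu mulrA -rmorphM mulVf ?gt_eqF// mul1r.
  by rewrite /e rmorphB rmorph1 mulrBl mul1r.
have fv1 : (1 - N) * cn v <= cn (f v).
  have : cn v <= cn (f v) + cn (f v - v).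
    by have := cnB (f v) (f v - v); rewrite opprB addrCA subrr addr0.
  by move: fv; lra.
set d := u - v in fuv *.
(* Multiplied by [f v], the left side becomes the quantity bounded by [fuv]; then divide using
   [|f v| >= (1 - N) |v|] and [M <= 1 - N]. *)
have key : cn (e%:C%C * v - d) <= cn d.
  have h : cn (f v) * cn (e%:C%C * v - d) <= M * cn d * cn v.
    rewrite -Normc.normcM (_ : f v * _ = v * (f u - f v) - d * f v)//.
    by rewrite fe; ring.
  have h2 : (1 - N) * cn v * cn (e%:C%C * v - d) <= M * cn d * cn v.
    by apply: le_trans h; rewrite ler_wpM2r ?cn_ge0.
  have h3 : (1 - N) * cn (e%:C%C * v - d) <= M * cn d.
    by rewrite -(ler_pM2r v0) mulrAC.
  have h4 : M * cn d <= (1 - N) * cn d by rewrite ler_wpM2r ?cn_ge0//; lra.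
  by have := le_trans h3 h4; rewrite ler_pM2l//; lra.
have key2 := key; rewrite -(@ler_pXn2r _ 2)// ?nnegrE ?cn_ge0// in key2.
have ud : u = v + d by rewrite /d addrC subrK.
rewrite -(@ler_pXn2r _ 2)// ?nnegrE ?cn_ge0// ud.
(* [aux] divides by [e]. For [e = 0], that is [f u = f v], the bound [fuv] and [M < 1 - N] force
   [u = v]. *)
have [e00|en0] := eqVneq e 0.
  suff -> : d = 0 by rewrite addr0.
  apply/eqP; rewrite -cn_eq0 eq_le cn_ge0 andbT.
  have h : cn d * cn (f v) <= M * cn d * cn v.
    by move: fuv; rewrite fe e00 rmorph0 mul0r mulr0 sub0r cnN Normc.normcM.
  have h2 : cn d * ((1 - N) * cn v) <= M * cn d * cn v.
    by apply: le_trans h; rewrite ler_wpM2l ?cn_ge0.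
  have h3 : cn d * ((1 - N - M) * cn v) <= 0 by lra.
  move: h3; rewrite pmulr_lle0// mulr_gt0//; lra.
have egt0 : 0 < e by rewrite lt_def en0.
exact: aux egt0 key2.
Qed.

(** * A starlikeness criterion *)

Lemma unit_discE {R : realType} (z : R[i]^o) : unit_disc z <-> cn z < 1.
Proof. by rewrite /unit_disc /= cnE -ltcR. Qed.

Lemma is_derive_quadratic {R : realType} (f : R[i]^o -> R[i]^o) (K : R)
    (z d : R[i]^o) : cn z < 1 ->
  (forall w : R[i]^o, cn w <= 1 ->
    cn (f w - f z - (w - z) * d) <= K * cn (w - z) ^+ 2) ->
  is_derive z (1 : R[i]^o) f d.
Proof.
move=> z1 fd.
have K1 : 0 < `|K| + 1 by rewrite ltr_wpDl.
have cv : ((fun h : R[i]^o =>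
    h^-1 *: ((f \o shift z) (h *: (1 : R[i]^o)) - f z)) @ (0 : R[i]^o)^' --> d)%classic.
  apply/cvgrPdist_lt => e e0.
  have [Ime Ree] : complex.Im e = 0 /\ 0 < complex.Re e.
    by move: e0; rewrite ltcE => /andP[/eqP].
  (* The first bound keeps [h + z] in the closed disc, the second makes [K |h|] smaller than the
     tolerance; [|K| + 1] is a positive divisor for any [K]. *)
  pose r := Num.min (1 - cn z) (complex.Re e / (`|K| + 1)).
  have r0 : 0 < r by rewrite lt_min subr_gt0 z1 divr_gt0.
  have rC0 : (0 : R[i]) < r%:C%C by rewrite ltcR.
  near=> h.
  have hr : cn h < r.
    rewrite -ltcR -cnE.
    near: h; exact: dnbhs0_lt.
  have h0 : h != 0 by near: h; exact: nbhs_dnbhs_neq.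
  have hpos : 0 < cn h by rewrite lt_def cn_eq0 h0 cn_ge0.
  have hz : cn (h + z) <= 1.
    rewrite (le_trans (cnD _ _))//; move: hr; rewrite lt_min => /andP[+ _]; lra.
  have := fd _ hz; rewrite addrK => hK.
  rewrite cnE.
  have -> : d - h^-1 *: ((f \o shift z) (h *: (1 : R[i]^o)) - f z) =
      - (h^-1 * (f (h + z) - f z - h * d)).
    rewrite /GRing.scale /= mulr1; field; exact: h0.
  rewrite cnN Normc.normcM Normc.normcV.
  suff : (cn h)^-1 * cn (f (h + z) - f z - h * d) < complex.Re e.
    rewrite -ltcR => /lt_le_trans; apply.
    by rewrite lecE /= Ime eqxx lexx.
  rewrite mulrC ltr_pdivrMr// (le_lt_trans hK)// expr2 mulrA ltr_pM2r//.
  move: hr; rewrite lt_min => /andP[_]; rewrite ltr_pdivlMr// mulrC => h2.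
  apply: le_lt_trans h2; rewrite ler_wpM2r ?cn_ge0//.
  by rewrite (le_trans (ler_norm _))// lerDl.
apply: DeriveDef; first by apply/cvg_ex; exists d.
by apply/cvg_lim.
Unshelve. all: end_near. Qed.

(** The set is a union of segments, continuous images of [[0, 1]], all containing 0. *)
Lemma connected_star_shaped {R : realType} (A : set R[i]^o) :
  A !=set0 -> star_shaped0 A -> connected A.
Proof.
move=> [w0 Aw0] sA.
pose S (w : R[i]^o) : set R[i]^o := (fun t : R => t%:C%C * w) @` `[0, 1].
have -> : A = \bigcup_(w in A) S w.
  apply/seteqP; split=> [w Aw|_ [w Aw [t t01 <-]]].
    exists w => //; exists 1; last by rewrite rmorph1 mul1r.
    by rewrite /= in_itv /= ler01 lexx.
  by apply: sA => //; move: t01; rewrite /= in_itv.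
apply: bigcup_connected.
  exists 0 => w _; exists 0; last by rewrite rmorph0 mul0r.
  by rewrite /= in_itv /= ler01 lexx.
move=> w _; apply: connected_continuous_connected.
  exact: segment_connected.
apply: continuous_subspaceT => t0.
apply/cvgrPdist_lt => e e0.
have [Ime Ree] : complex.Im e = 0 /\ 0 < complex.Re e.
  by move: e0; rewrite ltcE => /andP[/eqP].
have w1 : 0 < cn w + 1 by rewrite ltr_wpDl// cn_ge0.
have r0 : 0 < complex.Re e / (cn w + 1) by rewrite divr_gt0.
near=> t.
have tt : `|t0 - t| < complex.Re e / (cn w + 1).
  by near: t; exact: cvgr_dist_lt.
rewrite cnE -mulrBl -rmorphB Normc.normcM cn_real.
suff : `|t0 - t| * cn w < complex.Re e.
  rewrite -ltcR => /lt_le_trans; apply.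
  by rewrite lecE /= Ime eqxx lexx.
move: tt; rewrite ltr_pdivlMr//; apply: le_lt_trans.
by rewrite ler_wpM2l// lerDl.
Unshelve. all: end_near. Qed.

Section Criterion.
Context {R : realType} (f : R[i]^o -> R[i]^o) (M N K : R).
Hypotheses (M0 : 0 <= M) (N0 : 0 <= N) (MN : M + N < 1).
(** The bounds are assumed on the closed disc because the ball of radius [1 - |z|] around [z], on
    which [f] is inverted, touches the unit circle. *)
Hypothesis f_near_id : forall u v : R[i]^o, cn u <= 1 -> cn v <= 1 ->
  cn (f u - f v - (u - v)) <= (M + N) * cn (u - v).
Hypothesis f_ratio : forall u v : R[i]^o, cn u <= 1 -> cn v <= 1 ->
  cn (v * (f u - f v) - (u - v) * f v) <= M * cn (u - v) * cn v.
Hypothesis f_near_id0 : forall v : R[i]^o, cn v <= 1 -> cn (f v - v) <= N * cn v.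
Hypothesis f_deriv : forall z : R[i]^o, cn z <= 1 ->
  exists d : R[i]^o, forall w : R[i]^o, cn w <= 1 ->
    cn (f w - f z - (w - z) * d) <= K * cn (w - z) ^+ 2.
Hypothesis f_deriv0 : forall w : R[i]^o, cn w <= 1 ->
  cn (f w - w) <= K * cn w ^+ 2.

Let MN0 : 0 <= M + N. Proof. by rewrite addr_ge0. Qed.

Let f0 : f 0 = 0.
Proof.
have : cn (f 0 - 0) <= N * cn (0 : R[i]).
  by apply: f_near_id0; rewrite Normc.normc0 ler01.
rewrite subr0 Normc.normc0 mulr0 => h.
by apply/eqP; rewrite -cn_eq0 eq_le h cn_ge0.
Qed.

Let f_inj (u v : R[i]^o) : cn u <= 1 -> cn v <= 1 -> f u = f v -> u = v.
Proof.
move=> u1 v1 uv; have := f_near_id u v u1 v1.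
rewrite uv subrr sub0r cnN => h.
have : (1 - (M + N)) * cn (u - v) <= 0 by rewrite mulrBl mul1r subr_le0.
rewrite pmulr_rle0 ?subr_gt0// => h'; apply/eqP.
by rewrite -subr_eq0 -cn_eq0 eq_le h' cn_ge0.
Qed.

Let f_surj (z y : R[i]^o) : cn z <= 1 ->
  cn (y - f z) <= (1 - (M + N)) * (1 - cn z) ->
  exists2 v : R[i]^o, cn (v - z) <= 1 - cn z & f v = y.
Proof.
move=> z1 yz; apply: near_id_surjective yz => //; first by lra.
have B (u : R[i]^o) : cn (u - z) <= 1 - cn z -> cn u <= 1.
  by move=> h; have := cnD (u - z) z; rewrite subrK; lra.
by move=> u v /B u1 /B v1; exact: f_near_id.
Qed.

Lemma star_shaped_criterion : star_shaped0 (f @` unit_disc).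
Proof.
move=> _ [z /unit_discE z1 <-] t /andP[t0 t1].
(* [radial_monotone] needs a positive scaling factor, so the endpoint 0 is treated apart. *)
have [-> |tn0] := eqVneq t 0.
  exists 0; last by rewrite rmorph0 mul0r.
  by apply/unit_discE; rewrite Normc.normc0 ltr01.
have tpos : 0 < t by rewrite lt_def tn0.
(* From any [v] with [|v| <= |z|], [f_surj] reaches every point within [gap] of [f v]; [n] is taken
   so large that [|f z| / n <= gap]. *)
pose gap := (1 - (M + N)) * (1 - cn z).
have gap0 : 0 < gap by rewrite mulr_gt0 ?subr_gt0.
pose n := (Num.trunc (cn (f z) / gap)).+1.
have n0 : 0 < n%:R :> R by rewrite ltr0n.
have ngap : cn (f z) <= n%:R * gap.
  rewrite -ler_pdivrMr// ltW//; exact: truncnS_gt.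
pose s j : R := 1 - j%:R * ((1 - t) / n%:R).
have s_ge j : (j <= n)%N -> t <= s j.
  move=> jn; have : j%:R / n%:R * (1 - t) <= 1 * (1 - t).
    by rewrite ler_wpM2r ?subr_ge0// ler_pdivrMr// mul1r ler_nat.
  have -> : j%:R / n%:R * (1 - t) = j%:R * ((1 - t) / n%:R).
    by rewrite mulrAC mulrA.
  by rewrite /s; lra.
have s_le j : s j <= 1.
  by rewrite /s gerBl mulr_ge0// divr_ge0// subr_ge0.
have path j : (j <= n)%N ->
    exists2 v : R[i]^o, cn v <= cn z & f v = (s j)%:C%C * f z.
  elim: j => [_|j IH jn].
    by exists z; rewrite // /s mul0r subr0 rmorph1 mul1r.
  have [v vz fv] := IH (ltnW jn).
  have v1 : cn v <= 1 by rewrite (le_trans vz)// ltW.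
  have [||w wv fw] := f_surj v ((s j.+1)%:C%C * f z); first exact: v1.
    rewrite fv -mulrBl -rmorphB Normc.normcM cn_real.
    have -> : s j.+1 - s j = - ((1 - t) / n%:R) by rewrite /s -natr1; ring.
    rewrite normrN ger0_norm; last by rewrite divr_ge0// subr_ge0.
    have : (1 - t) / n%:R * cn (f z) <= 1 / n%:R * (n%:R * gap).
      by rewrite ler_pM ?cn_ge0 ?divr_ge0 ?subr_ge0// ler_pM2r ?invr_gt0//; lra.
    rewrite mul1r mulKf ?gt_eqF// => /le_trans; apply.
    by rewrite ler_wpM2l ?subr_ge0 ?(ltW MN)// lerD2l lerN2.
  have w1 : cn w <= 1.
    by have := cnD (w - v) v; rewrite subrK; lra.
  exists w => //.
  (* Comparing with the starting point [z], not with [v], restores [|w| <= |z|], so [gap] does not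
     shrink along the path. *)
  apply: (radial_monotone f M N (s j.+1)) => //.
  - by rewrite (lt_le_trans tpos)// s_ge.
  - exact: f_near_id0.
  - by apply: f_ratio => //; rewrite ltW.
have [v vz fv] := path n (leqnn n).
exists v; first by apply/unit_discE; rewrite (le_lt_trans vz).
suff sn : s n = t by rewrite fv sn.
by rewrite /s [_ * (_ / _)]mulrC divfK ?gt_eqF// opprB addrC subrK.
Qed.

Lemma open_criterion : open (f @` unit_disc).
Proof.
rewrite openE => _ [z /unit_discE z1 <-].
(* Half of the distance to the circle keeps the preimages in the open disc. *)
pose e := (1 - (M + N)) * ((1 - cn z) / 2).
have e0 : 0 < e by rewrite mulr_gt0 ?divr_gt0 ?subr_gt0.
have eC0 : (0 : R[i]) < e%:C%C by rewrite ltcR.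
apply/nbhs_ballP; exists e%:C%C => //= y.
rewrite -ball_normE /= cnE ltcR => fzy.
have [|||||v vz fv] := near_id_surjective f (M + N) ((1 - cn z) / 2) z y.
- exact: MN0.
- by [].
- by rewrite divr_ge0// subr_ge0 ltW.
- have B (u : R[i]^o) : cn (u - z) <= (1 - cn z) / 2 -> cn u <= 1.
    by move=> h; have := cnD (u - z) z; rewrite subrK; lra.
  by move=> u v /B u1 /B v1; exact: f_near_id.
- by rewrite cn_subC ltW.
exists v => //; apply/unit_discE.
by have := cnD (v - z) z; rewrite subrK; lra.
Qed.

Lemma starlike_criterion : starlike f.
Proof.
have an : analytic_on unit_disc f.
  move=> z /unit_discE z1; have [d fd] := f_deriv z (ltW z1).
  by have [] := is_derive_quadratic f K z d z1 fd.
have im0 : (f @` unit_disc) !=set0.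
  by exists (f 0); exists 0 => //; apply/unit_discE; rewrite Normc.normc0 ltr01.
split; split => //.
(* [f_deriv] leaves the derivative unspecified; at 0 it is identified by [f_deriv0]. *)
- have : is_derive (0 : R[i]^o) (1 : R[i]^o) f 1.
    apply: (is_derive_quadratic f K); first by rewrite Normc.normc0 ltr01.
    by move=> w w1; rewrite f0 !subr0 mulr1; exact: f_deriv0.
  by move=> fd; rewrite derive1E derive_val.
- split=> // u v; rewrite !inE => /unit_discE u1 /unit_discE v1.
  by apply: f_inj; exact: ltW.
- split; [exact: im0|exact: open_criterion|].
  exact: connected_star_shaped im0 star_shaped_criterion.
- exact: star_shaped_criterion.
Qed.
End Criterion.

(** * Power series *)

Section PowerSeries.
Context {R : realType} (c : nat -> R) (M N K : R).
Hypothesis c_ge0 : forall k, 0 <= c k.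
Hypothesis c0 : c 0%N = 1.
Hypothesis sum_c : forall n, \sum_(0 <= k < n) c k <= 1 + N.
Hypothesis sum_kc : forall n, \sum_(0 <= k < n) k%:R * c k <= M.
Hypothesis sum_kkc : forall n, \sum_(0 <= k < n) (k * k.+1)%:R * c k <= K.

Let fn n (z : R[i]^o) : R[i]^o :=
  series (fun k => (c k)%:C%C * z ^+ k.+1 : R[i]^o) n.
Let f (z : R[i]^o) : R[i]^o := limn (fn ^~ z).
(** The divided difference of the partial sum [fn n], in a form that still makes sense for [w = z],
    where it is the derivative. [H n z] is likewise the polynomial [fn n z / z]. *)
Let E n (w z : R[i]^o) : R[i]^o :=
  \sum_(0 <= k < n) (c k)%:C%C * \sum_(i < k.+1) w ^+ (k - i) * z ^+ i.
Let H n (z : R[i]^o) : R[i]^o := \sum_(0 <= k < n) (c k)%:C%C * z ^+ k.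

Let cnX_le1 (z : R[i]^o) k : cn z <= 1 -> cn (z ^+ k) <= 1.
Proof. by move=> z1; rewrite cnX exprn_ile1 ?cn_ge0. Qed.

Let cn_coef k (z : R[i]^o) : cn ((c k)%:C%C * z) = c k * cn z.
Proof. by rewrite Normc.normcM cn_real ger0_norm. Qed.

Let fnB n w z : fn n w - fn n z = (w - z) * E n w z.
Proof.
rewrite /fn /series /= -sumrB mulr_sumr; apply: eq_bigr => k _.
rewrite -mulrBr subrXX mulrCA; congr (_ * _); congr (_ * _).
Qed.

Let fnE n z : fn n z = z * H n z.
Proof.
rewrite /fn /series /= mulr_sumr; apply: eq_bigr => k _.
by rewrite exprS mulrCA.
Qed.

Let EBH n u v : cn u <= 1 -> cn v <= 1 -> cn (E n u v - H n v) <= M.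
Proof.
move=> u1 v1; apply: le_trans (sum_kc n).
rewrite /E /H -sumrB (le_trans (cn_sum _ _ _ _))//; apply: ler_sum => k _.
(* The last inner term of [E] is [v^k], which cancels the term of [H]; [k] products of modulus at
   most 1 remain. *)
rewrite -mulrBr cn_coef mulrC ler_wpM2r// big_ord_recr /= subnn expr0 mul1r addrK.
rewrite (le_trans (cn_sum _ _ _ _))// -[X in X%:R]card_ord -sumr_const.
by apply: ler_sum => i _; rewrite Normc.normcM mulr_ile1 ?cn_ge0 ?cnX_le1.
Qed.

(** The index [n + 1] guarantees that the sum contains its constant term [c 0 = 1]. *)
Let HB1 n v : cn v <= 1 -> cn (H n.+1 v - 1) <= N.
Proof.
move=> v1; rewrite /H big_ltn// c0 expr0 mulr1 rmorph1 addrC addKr.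
have := sum_c n.+1; rewrite (big_ltn (ltn0Sn n)) c0 lerD2l; apply: le_trans.
rewrite (le_trans (cn_sum _ _ _ _))//; apply: ler_sum => k _.
by rewrite cn_coef ler_piMr// cnX_le1.
Qed.

Let cnXB k (w z : R[i]^o) : cn w <= 1 -> cn z <= 1 ->
  cn (w ^+ k - z ^+ k) <= k%:R * cn (w - z).
Proof.
move=> w1 z1; rewrite subrXX Normc.normcM mulrC ler_wpM2r ?cn_ge0//.
rewrite (le_trans (cn_sum _ _ _ _))// -[X in X%:R]card_ord -sumr_const.
by apply: ler_sum => i _; rewrite Normc.normcM mulr_ile1 ?cn_ge0 ?cnX_le1.
Qed.

(** Each of the [k + 1] inner terms changes by at most [k |w - z|], hence the weight [k (k + 1)]
    defining [K]. *)
Let EB n w z : cn w <= 1 -> cn z <= 1 -> cn (E n w z - E n z z) <= K * cn (w - z).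
Proof.
move=> w1 z1; apply: le_trans (ler_wpM2r (cn_ge0 _) (sum_kkc n)).
rewrite mulr_suml /E -sumrB (le_trans (cn_sum _ _ _ _))//; apply: ler_sum => k _.
rewrite -mulrBr cn_coef mulrAC mulrC ler_wpM2r// -sumrB.
rewrite (le_trans (cn_sum _ _ _ _))//.
apply: (@le_trans _ _ (\sum_(i < k.+1) k%:R * cn (w - z))); last first.
  by rewrite sumr_const card_ord natrM -mulrnAl mulr_natr.
apply: ler_sum => i _; rewrite -mulrBl Normc.normcM.
rewrite (@le_trans _ _ (cn (w ^+ (k - i) - z ^+ (k - i))))//.
  by rewrite ler_piMr ?cn_ge0 ?cnX_le1.
by rewrite (le_trans (cnXB _ _ _ _ _))// ler_wpM2r ?cn_ge0// ler_nat leq_subr.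
Qed.

Let cvg_fn z : cn z <= 1 -> (fn n z @[n --> \oo] --> f z)%classic.
Proof.
move=> z1; apply: (@complex_series_cvg _ _ (1 + N)) => n.
apply: le_trans (sum_c n); apply: ler_sum => k _.
by rewrite cn_coef ler_piMr// cnX_le1.
Qed.

Let cvg_E z : cn z <= 1 ->
  exists d : R[i]^o, (E n z z @[n --> \oo] --> d)%classic.
Proof.
move=> z1; apply/cvg_ex; apply: (@complex_series_cvg _ _ (M + (1 + N))) => n.
apply: le_trans (lerD (sum_kc n) (sum_c n)).
rewrite -big_split; apply: ler_sum => k _ /=.
rewrite cn_coef -[X in _ + X]mul1r -mulrDl natr1 mulrC ler_wpM2r//.
rewrite (le_trans (cn_sum _ _ _ _))// -[X in X%:R]card_ord -sumr_const.
by apply: ler_sum => i _; rewrite Normc.normcM mulr_ile1 ?cn_ge0 ?cnX_le1.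
Qed.

Let E00 n : E n.+1 0 0 = 1.
Proof.
rewrite /E big_ltn// c0 rmorph1 mul1r big_ord_recr big_ord0 /= add0r mul1r.
rewrite big_nat big1 ?addr0// => k /andP[k0 _]; rewrite big1 ?mulr0// => i _.
by rewrite -exprD subnK -1?ltnS// expr0n; case: k k0 {i}.
Qed.

Lemma starlike_power_series : 0 <= M -> 0 <= N -> M + N < 1 -> starlike f.
Proof.
move=> M0 N0 MN.
apply: (starlike_criterion f M N K) => //.
- move=> u v u1 v1.
  apply: (@cn_lim_le _ (fun n => fn n u - fn n v - (u - v))).
    exact: (cvgB (cvgB (cvg_fn _ u1) (cvg_fn _ v1)) (cvg_cst _)).
  (* The empty partial sum lacks the leading term [z], so the estimate starts at index 1; it then
     passes to the limit. *)
  exists 1%N => // -[//|n] _.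
  rewrite fnB -[X in _ - X]mulr1 -mulrBr Normc.normcM mulrC ler_wpM2r ?cn_ge0//.
  have -> : E n.+1 u v - 1 = (E n.+1 u v - H n.+1 v) + (H n.+1 v - 1).
    by rewrite addrA subrK.
  by rewrite (le_trans (cnD _ _))// lerD// ?EBH ?HB1.
- move=> u v u1 v1.
  apply: (@cn_lim_le _ (fun n => v * (fn n u - fn n v) - (u - v) * fn n v)).
    apply: (cvgB (cvgM (cvg_cst v) (cvgB (cvg_fn _ u1) (cvg_fn _ v1)))).
    exact: (cvgM (cvg_cst _) (cvg_fn _ v1)).
  apply: nearW => n.
  have -> : v * (fn n u - fn n v) - (u - v) * fn n v =
    (E n u v - H n v) * ((u - v) * v) by rewrite fnB fnE; ring.
  by rewrite !Normc.normcM -mulrA ler_wpM2r ?mulr_ge0 ?cn_ge0// EBH.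
- move=> v v1; apply: (@cn_lim_le _ (fun n => fn n v - v)).
    exact: (cvgB (cvg_fn _ v1) (cvg_cst _)).
  exists 1%N => // -[//|n] _.
  rewrite fnE -[X in _ - X]mulr1 -mulrBr Normc.normcM mulrC.
  by rewrite ler_wpM2r ?cn_ge0// HB1.
- move=> z z1; have [d Ed] := cvg_E z z1; exists d => w w1.
  apply: (@cn_lim_le _ (fun n => fn n w - fn n z - (w - z) * E n z z)).
    apply: (cvgB (cvgB (cvg_fn _ w1) (cvg_fn _ z1))).
    exact: (cvgM (cvg_cst _) Ed).
  apply: nearW => n; rewrite fnB -mulrBr Normc.normcM mulrC expr2 mulrA.
  by rewrite ler_wpM2r ?cn_ge0// EB.
- move=> w w1; apply: (@cn_lim_le _ (fun n => fn n w - w)).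
    exact: (cvgB (cvg_fn _ w1) (cvg_cst _)).
  have z1 : cn (0 : R[i]^o) <= 1 by rewrite Normc.normc0 ler01.
  exists 1%N => // -[//|n] _.
  have -> : fn n.+1 w - w = (w - 0) * (E n.+1 w 0 - E n.+1 0 0).
    by rewrite E00 mulrBr -fnB mulr1 fnE (fnE _ 0) mul0r !subr0.
  rewrite Normc.normcM mulrC -[in leRHS](subr0 w) expr2 mulrA.
  by rewrite ler_wpM2r ?cn_ge0// EB.
Qed.

End PowerSeries.

(** * Log-concave coefficient sequences *)

Lemma expR1_ge {R : realType} : 8 / 3 <= expR 1 :> R.
Proof.
have h : 1 + 1 / 40 <= expR (1 / 40) :> R by exact: expR_ge1Dx.
(* [e = (e^(1/40))^40 >= (41/40)^40], which is about 2.685 and exceeds [8/3]. *)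
have -> : (1 : R) = 40%:R * (1 / 40) by field.
rewrite expRM_natl.
have : (1 + 1 / 40) ^+ 40 <= expR (1 / 40) ^+ 40 :> R.
  by rewrite lerXn2r ?nnegrE ?expR_ge0//; lra.
apply: le_trans.
have -> : (1 + 1 / 40 : R) = 41 / 40 by field.
rewrite expr_div_n ler_pdivlMr ?exprn_gt0//.
lra.
Qed.

Lemma five_le_3expR1 {R : realType} (x y : R) :
  0 <= y -> 2 * x + 5 * y <= 2 * x + 3 * (expR 1 - 1) * y.
Proof.
by move=> y0; rewrite lerD2l ler_wpM2r//; have := @expR1_ge R; lra.
Qed.

(* Telescoping against the potential [P k * c k]. *)
Lemma sum_le_potential {R : realType} (q : R) (c w P : nat -> R) (n : nat) :
  (forall k, 0 <= c k) -> (forall k, c k.+2 <= q * c k.+1) ->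
  (forall k, 0 <= w k) -> (forall k, 0 <= P k) ->
  (forall k, w k.+2 + q * P k.+3 <= P k.+2) ->
  \sum_(0 <= k < n) w k * c k <= w 0%N * c 0%N + w 1%N * c 1%N + P 2%N * c 2%N.
Proof.
move=> c_ge0 cq w_ge0 P_ge0 wP.
(* Two more nonnegative terms are added so that indices 0 and 1 can be split off for every [n]. *)
apply: (@le_trans _ _ (\sum_(0 <= k < n.+2) w k * c k)).
  by rewrite !big_nat_recr//= -addrA lerDl addr_ge0 ?mulr_ge0.
rewrite 2?big_nat_recl// addrA lerD2l.
suff : \sum_(0 <= k < n) w k.+2 * c k.+2 + P n.+2 * c n.+2 <= P 2%N * c 2%N.
  by have := mulr_ge0 (P_ge0 n.+2) (c_ge0 n.+2); lra.
elim: n => [|n IH]; first by rewrite big_geq// add0r.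
rewrite big_nat_recr//=.
have h1 := ler_wpM2l (P_ge0 n.+3) (cq n.+1).
have h2 := ler_wpM2r (c_ge0 n.+2) (wP n).
lra.
Qed.

Section LogConcave.
Context {R : realType} (c : nat -> R).
Hypothesis c_gt0 : forall k, 0 < c k.
Hypothesis c0 : c 0%N = 1.
Hypothesis c_log_concave : forall k, c k * c k.+2 <= c k.+1 ^+ 2.
Hypothesis c_small : 2 * c 1%N + 5 * c 2%N < 1.

(* If [c 2 > 29/100 * c 1] then [c 1 > 29/100] because [c 2 <= c 1 ^ 2], and
   [2 * 29/100 + 5 * (29/100) ^ 2 > 1]. *)
Lemma log_concave_ratio1 : c 2%N <= 29 / 100 * c 1%N.
Proof.
rewrite leNgt; apply/negP => h.
have c1 := c_gt0 1.
have : c 1%N * (29 / 100) < c 1%N * c 1%N.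
  by have := c_log_concave 0; rewrite c0 mul1r expr2; lra.
rewrite ltr_pM2l// => c1q.
by have := c_small; lra.
Qed.

Lemma log_concave_ratio k : c k.+2 <= 29 / 100 * c k.+1.
Proof.
(* The ratios are nonincreasing, written without division: [c (k+2) / c (k+1) <= c 2 / c 1]. *)
have mono : c 1%N * c k.+2 <= c 2%N * c k.+1.
  elim: k => [|k IH]; first by rewrite mulrC.
  rewrite -(ler_pM2l (c_gt0 k.+1)).
  have h := ler_wpM2l (ltW (c_gt0 1)) (c_log_concave k.+1).
  rewrite mulrCA (le_trans h)//.
  have := ler_wpM2r (ltW (c_gt0 k.+2)) IH.
  by rewrite expr2; lra.
rewrite -(ler_pM2l (c_gt0 1)) (le_trans mono)//.
have := ler_wpM2r (ltW (c_gt0 k.+1)) log_concave_ratio1.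
by lra.
Qed.

(** The potentials are the solutions of [P k = w k + q P (k+1)] for [q = 29/100], with coefficients
    rounded up. The roundings for [M] and [N] must be fine, as [17/5 + 3/2 = 49/10] has to stay
    below the 5 of [c_small]; [K] only has to be finite. *)
Lemma starlike_log_concave :
  starlike (fun z : R[i]^o =>
    limn (series (fun k => (c k)%:C%C * z ^+ k.+1 : R[i]^o))).
Proof.
have c_ge0 k : 0 <= c k by exact: ltW.
have sums := sum_le_potential (29 / 100) c.
have x0 k : 0 <= k%:R :> R by [].
apply: (starlike_power_series c (c 1%N + 17 / 5 * c 2%N) (c 1%N + 3 / 2 * c 2%N)
  (2 * c 1%N + 28 * c 2%N)) => //.
- move=> n; under eq_bigr do rewrite -[c _]mul1r.
  apply: le_trans (sums (fun=> 1) (fun=> 3 / 2) n c_ge0 log_concave_ratio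
    _ _ _) _.
  + by [].
  + by move=> k; rewrite divr_ge0.
  + by move=> k; lra.
  + by rewrite c0; lra.
- move=> n; apply: le_trans (sums (fun k => k%:R)
    (fun k => 141 / 100 * k%:R + 58 / 100) n c_ge0 log_concave_ratio _ _ _) _.
  + by [].
  + by move=> k; have := x0 k; lra.
  + by move=> k; rewrite -3!natr1; have := x0 k; lra.
  + by rewrite c0; lra.
- move=> n; apply: le_trans (sums (fun k => (k * k.+1)%:R)
    (fun k => 2 * k%:R ^+ 2 + 6 * k%:R + 8) n c_ge0 log_concave_ratio _ _ _) _.
  + by [].
  + by move=> k; have := x0 k; have := sqr_ge0 (k%:R : R); lra.
  + move=> k; rewrite natrM -3!natr1; have := x0 k.
    by have := sqr_ge0 (k%:R : R); lra.
  + by rewrite c0; lra.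
- by have := c_ge0 1; have := c_ge0 2; lra.
- by have := c_ge0 1; have := c_ge0 2; lra.
- by have := c_ge0 2; have := c_small; lra.
Qed.

End LogConcave.

(** * The coefficients of the Wright function *)

Lemma wright_coef_gt0 {R : realType} (mu a nu b : R) k :
  0 < a -> 0 < b -> 0 < mu -> 0 < nu -> 0 < wright_coef mu a nu b k.
Proof.
move=> a0 b0 mu0 nu0.
by rewrite divr_gt0 ?mulr_gt0 ?Gamma_gt0// ltr_wpDr// mulr_ge0// ltW.
Qed.

Lemma wright_coef0 {R : realType} (mu a nu b : R) :
  0 < a -> 0 < b -> wright_coef mu a nu b 0 = 1.
Proof.
move=> a0 b0; rewrite /wright_coef !mul0r !addr0 divff//.
by rewrite mulf_neq0// gt_eqF// Gamma_gt0.
Qed.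

(** A product of log-convex sequences is log-convex, and a constant over it is log-concave. *)
Lemma ratio_log_concave {R : realFieldType} (p x0 x1 x2 y0 y1 y2 : R) :
  0 < x0 -> 0 < x1 -> 0 < x2 -> 0 < y0 -> 0 < y1 -> 0 < y2 ->
  x1 ^+ 2 <= x0 * x2 -> y1 ^+ 2 <= y0 * y2 ->
  p / (x0 * y0) * (p / (x2 * y2)) <= (p / (x1 * y1)) ^+ 2.
Proof.
move=> x00 x10 x20 y00 y10 y20 x012 y012.
rewrite mulf_div expr_div_n -expr2 ler_wpM2l ?sqr_ge0//.
rewrite lef_pV2 ?posrE ?exprn_gt0 ?mulr_gt0// exprMn [leRHS]mulrACA.
by rewrite ler_pM ?sqr_ge0.
Qed.

Lemma wright_coef_log_concave {R : realType} (mu a nu b : R) k :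
  0 < a -> 0 < b -> 0 < mu -> 0 < nu ->
  wright_coef mu a nu b k * wright_coef mu a nu b k.+2 <=
    wright_coef mu a nu b k.+1 ^+ 2.
Proof.
move=> a0 b0 mu0 nu0.
have pos (x h : R) j : 0 < x -> 0 < h -> 0 < x + j%:R * h.
  by move=> x0 h0; rewrite ltr_wpDr// mulr_ge0// ltW.
have conv (x h : R) : 0 < x -> 0 < h -> Gamma (x + k.+1%:R * h) ^+ 2 <=
    Gamma (x + k%:R * h) * Gamma (x + k.+2%:R * h).
  move=> x0 h0; have := Gamma_log_convex (x + k%:R * h) h (pos _ _ _ x0 h0) h0.
  have nS j : j.+1%:R * h = j%:R * h + h by rewrite -natr1 mulrDl mul1r.
  by rewrite !nS !addrA.
apply: ratio_log_concave; rewrite ?conv ?Gamma_gt0 ?pos//.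
Qed.

Theorem theorem3p1 (R : realType) (a b mu nu : R)
  (a_gt0 : 0 < a) (b_gt0 : 0 < b) (mu_gt0 : 0 < mu) (nu_gt0 : 0 < nu)
  (cond1 : Gamma (a + 2 * mu) / Gamma (a + 3 * mu)
           < Gamma (b + 3 * nu) / (3 * Gamma (b + 2 * nu)))
  (cond2 : Gamma (a + mu) * Gamma (a + 3 * mu) / Gamma (a + 2 * mu) ^+ 2
           < 3 * Gamma (b + 2 * nu) ^+ 2
             / (2 * Gamma (b + nu) * Gamma (b + 3 * nu)))
  (cond3 : 2 * Gamma a * Gamma b / (Gamma (a + mu) * Gamma (b + nu))
           + 3 * (expR 1 - 1) * Gamma a * Gamma b
             / (Gamma (a + 2 * mu) * Gamma (b + 2 * nu)) < 1) :
  starlike (wright mu a nu b).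
Proof.
apply: starlike_log_concave => [k|||].
- exact: wright_coef_gt0.
- exact: wright_coef0.
- by move=> k; exact: wright_coef_log_concave.
(* In terms of the coefficients, [cond3] reads [2 c1 + 3 (e - 1) c2 < 1], and [3 (e - 1) >= 5]. *)
have c1 : 2 * wright_coef mu a nu b 1 =
    2 * Gamma a * Gamma b / (Gamma (a + mu) * Gamma (b + nu)).
  by rewrite /wright_coef !mul1r !mulrA.
have c2 : 3 * (expR 1 - 1) * wright_coef mu a nu b 2 =
    3 * (expR 1 - 1) * Gamma a * Gamma b
      / (Gamma (a + 2 * mu) * Gamma (b + 2 * nu)).
  by rewrite /wright_coef !mulrA.
rewrite -c1 -c2 in cond3; apply: le_lt_trans cond3.
by apply: five_le_3expR1; apply: ltW; exact: wright_coef_gt0.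
Qed.
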